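(* Let $n\ge 2$ and let $\rho:\mathcal{B}_n\to GL(V)$ be any indecomposable finite-dimensional complex representation of the braid group $\mathcal{B}_n$ such that $\rho(\gamma^{2n})=c_\rho\,\mathrm{Id}_V$ for some scalar $c_\rho$ (for example, any irreducible $\rho$). Then $\rho$ extends to an indecomposable representation of the necklace braid group $\mathcal{NB}_n$ on $V$ by $$\rho(\sigma_n)=\rho(\gamma\sigma_{n-1}\gamma^{-1})\qquad\text{and}\qquad \rho(\tau)=(c_\rho)^{-1/2n}\,\rho(\gamma),$$ where $(c_\rho)^{-1/2n}$ denotes a $2n$-th root of $c_\rho^{-1}$.
   Context: The braid group $\mathcal{B}_n$ is generated by $\sigma_1,\dots,\sigma_{n-1}$ with relations $\sigma_i\sigma_{i+1}\sigma_i=\sigma_{i+1}\sigma_i\sigma_{i+1}$ and $\sigma_i\sigma_j=\sigma_j\sigma_i$ for $|i-j|>1$. Put $\gamma=\sigma_1\sigma_2\cdots\sigma_{n-1}\in\mathcal{B}_n$. The necklace braid group $\mathcal{NB}_n$ is the group with generators $\sigma_1,\dots,\sigma_n,\tau$ and relations, with all indices taken modulo $n$: (B1) $\sigma_i\sigma_{i+1}\sigma_i=\sigma_{i+1}\sigma_i\sigma_{i+1}$ for all $i$; (B2) $\sigma_i\sigma_j=\sigma_j\sigma_i$ whenever $i-j\not\equiv\pm1\pmod n$; (N1) $\tau\sigma_i\tau^{-1}=\sigma_{i+1}$ for $1\le i\le n$; (N2) $\tau^{2n}=1$. *)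

(* Defs.v *)
From HB Require Import structures.
From mathcomp Require Import all_boot all_order all_algebra.
From mathcomp Require Import generic_quotient boolp.

Set Implicit Arguments.
Unset Strict Implicit.
Unset Printing Implicit Defensive.

Import GRing.Theory.
Local Open Scope quotient_scope.
Local Open Scope group_scope.

(* Words over T and formal inverses: the letter (x, true) stands for x and
   (x, false) for x^-1. *)
Definition word (T : Type) : Type := seq (T * bool).

Definition wgen (T : Type) (x : T) : word T := [:: (x, true)].

Definition winv (T : Type) (w : word T) : word T :=
  rev [seq (l.1, ~~ l.2) | l <- w].

(* The group < T | rels >: words modulo the smallest congruence containing
   free cancellation and rels. *)
Section Presentation.

Variables (T : choiceType) (rels : word T -> word T -> Prop).

Inductive pres_eq : word T -> word T -> Prop :=
| pres_refl u : pres_eq u u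
| pres_sym u v : pres_eq u v -> pres_eq v u
| pres_trans v u w : pres_eq u v -> pres_eq v w -> pres_eq u w
| pres_cat u u' v v' :
    pres_eq u u' -> pres_eq v v' -> pres_eq (u ++ v) (u' ++ v')
| pres_cancel x b : pres_eq [:: (x, b); (x, ~~ b)] [::]
| pres_rel u v : rels u v -> pres_eq u v.

Lemma pres_wVw w : pres_eq (winv w ++ w) [::].
Proof.
elim: w => [|[x b] w IHw]; first exact: pres_refl.
rewrite /winv /= rev_cons cat_rcons; apply: pres_trans IHw.
apply: pres_cat; first exact: pres_refl.
apply: (pres_cat (u := [:: (x, ~~ b); (x, b)]) (u' := [::]) _ (pres_refl w)).
by have := pres_cancel x (~~ b); rewrite negbK.
Qed.

Lemma pres_wwV w : pres_eq (w ++ winv w) [::].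
Proof.
have := pres_wVw (winv w); rewrite {1}/winv {1}/winv map_rev revK -map_comp.
rewrite (eq_map (g := id)) ?map_id // => -[x b] /=.
by rewrite negbK.
Qed.

Lemma pres_winv (u v : word T) : pres_eq u v -> pres_eq (winv u) (winv v).
Proof.
move=> uv; apply: (@pres_trans (winv u ++ (v ++ winv v))).
  rewrite -[X in pres_eq X _]cats0; apply: pres_cat; first exact: pres_refl.
  exact/pres_sym/pres_wwV.
rewrite catA -[X in pres_eq _ X]cat0s; apply: pres_cat (pres_refl _).
apply: pres_trans (pres_wVw u).
by apply: pres_cat (pres_sym uv); apply: pres_refl.
Qed.

Definition pres_eqb : rel (word T) := fun u v => `[< pres_eq u v >].

Lemma pres_eqb_refl : reflexive pres_eqb.
Proof. by move=> u; apply/asboolP; apply: pres_refl. Qed.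

Lemma pres_eqb_sym : symmetric pres_eqb.
Proof. by move=> u v; apply/asboolP/asboolP; apply: pres_sym. Qed.

Lemma pres_eqb_trans : transitive pres_eqb.
Proof.
by move=> v u w /asboolP uv /asboolP vw; apply/asboolP; apply: pres_trans uv vw.
Qed.

Canonical pres_equiv :=
  EquivRel pres_eqb pres_eqb_refl pres_eqb_sym pres_eqb_trans.

Definition presented : Type := {eq_quot pres_equiv}.

HB.instance Definition _ := Choice.on presented.

Definition pres_pi (w : word T) : presented := \pi_{eq_quot pres_equiv} w.
Definition pres_repr (x : presented) : word T := @repr _ {eq_quot pres_equiv} x.

Lemma pres_reprK : cancel pres_repr pres_pi.
Proof. exact: reprK. Qed.

Lemma pres_piP (u v : word T) : pres_pi u = pres_pi v <-> pres_eq u v.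
Proof.
have eqP := @eqquotP _ pres_equiv {eq_quot pres_equiv} u v.
by split=> [/eqP/asboolP|uv] //; apply/eqP/asboolP.
Qed.

Lemma pres_piK (u : word T) : pres_eq (pres_repr (pres_pi u)) u.
Proof. by apply/pres_piP; rewrite pres_reprK. Qed.

Definition pres_one : presented := pres_pi [::].
Definition pres_mul (x y : presented) : presented :=
  pres_pi (pres_repr x ++ pres_repr y).
Definition pres_inv (x : presented) : presented := pres_pi (winv (pres_repr x)).

Lemma pres_mulE u v : pres_mul (pres_pi u) (pres_pi v) = pres_pi (u ++ v).
Proof. by apply/pres_piP; apply: pres_cat; apply: pres_piK. Qed.

Lemma pres_invE u : pres_inv (pres_pi u) = pres_pi (winv u).
Proof. by apply/pres_piP/pres_winv/pres_piK. Qed.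

Lemma pres_mulA : associative pres_mul.
Proof.
move=> x y z; rewrite -[x]pres_reprK -[y]pres_reprK -[z]pres_reprK.
by rewrite !pres_mulE catA.
Qed.

Lemma pres_mul1 : left_id pres_one pres_mul.
Proof. by move=> x; rewrite -[x]pres_reprK pres_mulE. Qed.

Lemma pres_mulr1 : right_id pres_one pres_mul.
Proof. by move=> x; rewrite -[x]pres_reprK pres_mulE cats0. Qed.

Lemma pres_mulV : left_inverse pres_one pres_inv pres_mul.
Proof.
move=> x; rewrite -[x]pres_reprK pres_invE pres_mulE.
exact/pres_piP/pres_wVw.
Qed.

Lemma pres_mulrV : right_inverse pres_one pres_inv pres_mul.
Proof.
move=> x; rewrite -[x]pres_reprK pres_invE pres_mulE.
exact/pres_piP/pres_wwV.
Qed.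

HB.instance Definition _ := isGroup.Build presented
  pres_mulA pres_mul1 pres_mulr1 pres_mulV pres_mulrV.

Definition pres_gen (x : T) : presented := pres_pi (wgen x).

End Presentation.

(* B_n: the ordinal i : 'I_n.-1 indexes the generator sigma_{i+1}. *)
Inductive braid_rel (n : nat) : word 'I_n.-1 -> word 'I_n.-1 -> Prop :=
| braid_rel_braid (i j : 'I_n.-1) : j = i.+1 :> nat ->
    braid_rel (wgen i ++ wgen j ++ wgen i) (wgen j ++ wgen i ++ wgen j)
| braid_rel_comm (i j : 'I_n.-1) : (i.+1 < j) || (j.+1 < i) ->
    braid_rel (wgen i ++ wgen j) (wgen j ++ wgen i).

Definition braid_group (n : nat) : groupType := presented (@braid_rel n).

Definition bsigma (n : nat) (i : 'I_n.-1) : braid_group n :=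
  pres_gen (@braid_rel n) i.

Definition bgamma (n : nat) : braid_group n := \prod_(i < n.-1) bsigma i.

(* NB_n: Some i, for i : 'I_n, indexes sigma_{i+1}, and None indexes tau.
   ordS is the cyclic successor on 'I_n, so ordS i stands for the index i + 1
   modulo n. *)
Inductive necklace_rel (n : nat) :
    word (option 'I_n) -> word (option 'I_n) -> Prop :=
| necklace_rel_B1 (i : 'I_n) :
    let s := wgen (Some i) in let s' := wgen (Some (ordS i)) in
    necklace_rel (s ++ s' ++ s) (s' ++ s ++ s')
| necklace_rel_B2 (i j : 'I_n) : i != ordS j -> j != ordS i ->
    let s := wgen (Some i) in let s' := wgen (Some j) in
    necklace_rel (s ++ s') (s' ++ s)
| necklace_rel_N1 (i : 'I_n) :
    let t := wgen None in
    necklace_rel (t ++ wgen (Some i) ++ winv t) (wgen (Some (ordS i)))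
| necklace_rel_N2 :
    necklace_rel (flatten (nseq (2 * n) (wgen None))) [::].

Definition necklace_group (n : nat) : groupType := presented (@necklace_rel n).

Definition nsigma (n : nat) (i : 'I_n) : necklace_group n :=
  pres_gen (@necklace_rel n) (Some i).

Definition ntau (n : nat) : necklace_group n :=
  pres_gen (@necklace_rel n) None.

Section GL.

Variables (F : fieldType) (V : vectType F).

Record GL : Type := MkGL {
  GL_val :> 'End(V);
  GL_ker0 : lker GL_val == 0%VS
}.

HB.instance Definition _ := [isSub for GL_val].
HB.instance Definition _ := [Choice of GL by <:].

Lemma GL_one_subproof : lker (\1%VF : 'End(V)) == 0%VS.
Proof. by apply/lker0P => x y; rewrite !lfunE. Qed.

Lemma GL_mul_subproof (f g : GL) : lker (f \o g)%VF == 0%VS.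
Proof.
apply/lker0P => x y; rewrite !lfunE /=.
by move/(elimT lker0P (GL_ker0 f))/(elimT lker0P (GL_ker0 g)).
Qed.

Lemma GL_inv_subproof (f : GL) : lker (f^-1)%VF == 0%VS.
Proof. by apply/lker0P; apply: can_inj (lker0_lfunVK (GL_ker0 f)). Qed.

Definition GL_one : GL := MkGL GL_one_subproof.
Definition GL_mul (f g : GL) : GL := MkGL (GL_mul_subproof f g).
Definition GL_inv (f : GL) : GL := MkGL (GL_inv_subproof f).

Lemma GL_mulA : associative GL_mul.
Proof. by move=> f g h; apply/val_inj/comp_lfunA. Qed.

Lemma GL_mul1 : left_id GL_one GL_mul.
Proof. by move=> f; apply/val_inj/comp_lfun1l. Qed.

Lemma GL_mulr1 : right_id GL_one GL_mul.
Proof. by move=> f; apply/val_inj/comp_lfun1r. Qed.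

Lemma GL_mulV : left_inverse GL_one GL_inv GL_mul.
Proof. by move=> f; apply/val_inj/(lker0_compVf (GL_ker0 f)). Qed.

Lemma GL_mulrV : right_inverse GL_one GL_inv GL_mul.
Proof. by move=> f; apply/val_inj/(lker0_compfV (GL_ker0 f)). Qed.

HB.instance Definition _ := isGroup.Build GL
  GL_mulA GL_mul1 GL_mulr1 GL_mulV GL_mulrV.

End GL.

Section Representations.

Variables (F : fieldType) (V : vectType F) (G : groupType).
Implicit Types (rho : {multiplicative G -> GL V}) (U W : {vspace V}).

Definition invariant_subspace rho U : Prop :=
  forall g : G, ((rho g : 'End(V)) @: U <= U)%VS.

Definition irreducible rho : Prop :=
  (fullv : {vspace V}) <> 0%VS /\
  forall U, invariant_subspace rho U -> U = 0%VS \/ U = fullv.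

Definition indecomposable rho : Prop :=
  (fullv : {vspace V}) <> 0%VS /\
  forall U W, invariant_subspace rho U -> invariant_subspace rho W ->
    (U + W)%VS = fullv -> (U :&: W)%VS = 0%VS -> U = 0%VS \/ W = 0%VS.

End Representations.

(* Main.v *)
(** If [g = s_1 ... s_m] in the braid group, then [g s_i = s_(i+1) g] for
    [i < m] by the braid relations, and [s_1 g^2 = g^2 s_m] follows by writing
    [g = s_1 e = d s_m], since then [g d = e g].  Hence the conjugates
    [g^k s_1 g^-k] extend [s_1, ..., s_m] to a sequence of period [m + 1], whose
    relations are all conjugate to braid relations involving [s_1].  This gives
    the necklace relations, with [tau] acting as a scalar multiple of [g], and
    the centrality of [g^(m+1)], to which Schur's lemma applies. *)
Require Import Defs.
From HB Require Import structures.
From mathcomp Require Import all_boot all_order all_algebra.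
From mathcomp Require Import boolp reals complex.

Set Implicit Arguments.
Unset Strict Implicit.
Unset Printing Implicit Defensive.

Local Open Scope ring_scope.

(** * Homomorphisms of groups *)

Section GroupMorphism.
Local Open Scope group_scope.

Variables (G H : groupType) (phi : {multiplicative G -> H}).

Lemma multiplicative1 : phi 1 = 1.
Proof. by apply: (@mulgI _ (phi 1)); rewrite -gmulfM !mulg1. Qed.

Lemma multiplicativeV x : phi x^-1 = (phi x)^-1.
Proof. by apply/esym/mulg1_eq; rewrite -gmulfM mulgV multiplicative1. Qed.

Lemma multiplicativeX x k : phi (x ^+ k) = phi x ^+ k.
Proof.
by elim: k => [|k IHk]; rewrite ?multiplicative1 // !expgS gmulfM IHk.
Qed.

End GroupMorphism.

(** * Groups given by generators and relations *)

Section PresentedGroup.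
Local Open Scope group_scope.

Variables (T : choiceType) (rels : word T -> word T -> Prop).

Lemma pres_piM u v : pres_pi rels (u ++ v) = pres_pi rels u * pres_pi rels v.
Proof. exact/esym/pres_mulE. Qed.

Lemma presented_ind (P : presented rels -> Prop) :
    P 1 -> (forall x y, P x -> P y -> P (x * y)) ->
    (forall x, P x -> P x^-1) -> (forall a, P (pres_gen rels a)) ->
  forall x, P x.
Proof.
move=> P1 PM PV Pgen x; rewrite -[x]pres_reprK; elim: (pres_repr x) => // l w.
rewrite -cat1s pres_piM; apply: PM.
case: l => a [|]; first exact: Pgen.
rewrite (_ : [:: (a, false)] = winv (wgen a)) // -pres_invE.
exact/(PV (pres_pi _ _))/Pgen.
Qed.

Definition word_eval (H : groupType) (f : T -> H) (w : word T) : H :=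
  \prod_(l <- w) (if l.2 then f l.1 else (f l.1)^-1).

Lemma word_eval_cat (H : groupType) (f : T -> H) u v :
  word_eval f (u ++ v) = word_eval f u * word_eval f v.
Proof. exact: big_cat. Qed.

Lemma word_eval_gen (H : groupType) (f : T -> H) a : word_eval f (wgen a) = f a.
Proof. exact: big_seq1. Qed.

Lemma word_eval_genV (H : groupType) (f : T -> H) a :
  word_eval f (winv (wgen a)) = (f a)^-1.
Proof. exact: big_seq1. Qed.

(** Universal property of a presentation: evaluation in [H] respects each constructor of the
    congruence, so it can be computed on chosen representatives. *)
Lemma presented_lift (H : groupType) (f : T -> H) :
    (forall u v, rels u v -> word_eval f u = word_eval f v) ->
  exists phi : {multiplicative presented rels -> H},
    forall a, phi (pres_gen rels a) = f a.
Proof.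
move=> f_rels.
have f_eq u v : pres_eq rels u v -> word_eval f u = word_eval f v.
  elim=> {u v} [//|u v _ -> //|v u w _ -> _ -> //|u u' v v' _ IHu _ IHv|a b|].
  - by rewrite !word_eval_cat IHu IHv.
  - rewrite /word_eval big_cons big_seq1 big_nil /=.
    by case: b; rewrite ?mulgV ?mulVg.
  - exact: f_rels.
pose phi0 (x : presented rels) := word_eval f (pres_repr x).
have phi0_pi w : phi0 (pres_pi _ w) = word_eval f w by exact/f_eq/pres_piK.
have phi0M : {morph phi0 : x y / x * y}.
  by move=> x y; rewrite -word_eval_cat -phi0_pi.
pose phiM := isMultiplicative.Build _ _ phi0 phi0M.
pose phi : {multiplicative presented rels -> H} := HB.pack phi0 phiM.
by exists phi => a; rewrite [LHS]phi0_pi word_eval_gen.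
Qed.

End PresentedGroup.

(** * Sequences satisfying the braid relations in an arbitrary group *)

Section BraidRelations.
Local Open Scope group_scope.
Local Open Scope nat_scope.

Variables (G : groupType) (m : nat) (s : nat -> G).
Hypothesis braid_s :
  forall i, i.+1 < m -> (s i * s i.+1 * s i = s i.+1 * s i * s i.+1)%g.
Hypothesis comm_s : forall i j, i.+1 < j < m -> commute (s i) (s j).

Let g := (\prod_(0 <= i < m) s i)%g.

(** Split [g] as [p * s i * s i.+1 * q]: [q] commutes with [s i] and [p] with [s i.+1], so a single
    braid relation suffices. *)
Lemma coxeter_shift i : i.+1 < m -> (g * s i = s i.+1 * g)%g.
Proof.
move=> lt_im; rewrite /g (big_cat_nat (n := i)) ?(ltnW (ltnW lt_im)) //=.
rewrite (big_ltn (m := i)) ?(ltnW lt_im) // (big_ltn (m := i.+1)) //.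
set p := (\prod_(0 <= k < i) _)%g; set q := (\prod_(i.+2 <= k < m) _)%g.
have cp : commute (s i.+1) p.
  rewrite /p big_nat; apply: commute_prod => k /andP[_ lt_ki].
  by apply/commute_sym/comm_s; rewrite ltnS lt_ki.
have cq : commute (s i) q.
  by rewrite /q big_nat; apply: commute_prod => k; apply: comm_s.
rewrite -!mulgA -cq !mulgA -(mulgA p) -(mulgA p) braid_s //.
by rewrite cp !mulgA.
Qed.

Lemma coxeter_wrap : 0 < m -> (g * g * s m.-1 = s 0 * (g * g))%g.
Proof.
move=> m_gt0; pose e := (\prod_(1 <= k < m) s k)%g.
pose d := (\prod_(0 <= k < m.-1) s k)%g.
have gE : g = (s 0 * e)%g by rewrite /g big_ltn.
have gD : g = (d * s m.-1)%g.
  by rewrite /g -[X in index_iota 0 X](prednK m_gt0) big_nat_recr.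
have gd : (g * d = e * g)%g.
  (* [coxeter_shift] is applied to one factor of [d] at a time. *)
  suff gdk k : k <= m.-1 ->
      (g * \prod_(0 <= i < k) s i = \prod_(0 <= i < k) s i.+1 * g)%g.
    by rewrite /d /e big_add1 gdk.
  elim: k => [|k IHk] lt_km.
    by rewrite !big_nil mulg1 mul1g.
  rewrite !big_nat_recr //= mulgA IHk ?(ltnW lt_km) // -!mulgA coxeter_shift //.
  by rewrite -(prednK m_gt0) ltnS.
by rewrite [in X in (_ = _ * (_ * X))%g]gD (mulgA g) gd !mulgA -gE.
Qed.

(** Since [x ^ y] is [y^-1 * x * y], this is [g^k * s 0 * g^-k]. Indexing by all naturals turns the
    cyclic shift into a plain successor. *)
Definition necklace_seq k := (s 0 ^ (g ^- k))%g.
Local Notation t := necklace_seq.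

Lemma necklace_seqD k l : (t (k + l) = t l ^ (g ^- k))%g.
Proof. by rewrite /necklace_seq -conjgM expgnDr invgM. Qed.

Lemma necklace_seqS k : (g * t k * g^-1 = t k.+1)%g.
Proof. by rewrite -add1n necklace_seqD conjgE expg1 invgK -mulgA. Qed.

Lemma necklace_seq_id k : k < m -> t k = s k.
Proof.
elim: k => [|k IHk] lt_km; first by rewrite /t expg0 invg1 conjg1.
by rewrite -necklace_seqS IHk ?(ltnW lt_km) // coxeter_shift // mulgK.
Qed.

Lemma necklace_seq_period : 0 < m -> t m.+1 = s 0.
Proof.
move=> m_gt0; rewrite -(prednK m_gt0) -2!necklace_seqS.
rewrite necklace_seq_id ?ltn_predL // !mulgA coxeter_wrap //.
by rewrite mulgA !mulgK.
Qed.

(** Compute [t (m.+1 + k)] in two ways: as the conjugate of [t k = s k] by [g ^+ m.+1], and, by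
    periodicity, as [s k] itself. *)
Lemma commute_coxeterX k : k < m -> commute (g ^+ m.+1)%g (s k).
Proof.
move=> lt_km; have m_gt0 : 0 < m by case: (m) lt_km.
have := necklace_seqD m.+1 k; rewrite addnC necklace_seqD necklace_seq_period //.
rewrite -/(t k) necklace_seq_id // /commute => {2}->.
by rewrite conjgE invgK !mulgA mulgVK.
Qed.

Lemma necklace_seq_braid k :
  0 < m -> (t k * t k.+1 * t k = t k.+1 * t k * t k.+1)%g.
Proof.
move=> m_gt0; have tk := necklace_seqD k 0; have tk1 := necklace_seqD k 1.
rewrite addn0 in tk; rewrite addn1 in tk1; rewrite tk tk1 -!conjMg.
congr (_ ^ _)%g; rewrite (@necklace_seq_id 0) //.
(* For [m = 1] there is no [s 1] to use, but [g = s 0] and hence [t 1 = s 0]. *)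
have [lt_1m|le_m1] := ltnP 1 m; first by rewrite necklace_seq_id // braid_s.
have gE : g = s 0.
  by rewrite /g (_ : m = 1) ?big_nat1 //; apply/eqP; rewrite eqn_leq le_m1.
by rewrite -necklace_seqS necklace_seq_id // gE mulgK.
Qed.

(** Conjugation by a power of [g] reduces to [t 0] and [t (j - i)]. The bound [j - i < m] makes the
    latter equal to [s (j - i)]; distance [m] would make the two cyclic neighbours modulo [m.+1]. *)
Lemma necklace_seq_comm i j : i.+1 < j -> j - i < m -> commute (t i) (t j).
Proof.
move=> lt_ij lt_jim; rewrite -(subnKC (ltnW (ltnW lt_ij))).
rewrite necklace_seqD -[X in t X]addn0 necklace_seqD /commute -!conjMg; congr (_ ^ _)%g.
rewrite !necklace_seq_id //; last by case: (m) lt_jim.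
by apply: comm_s; rewrite ltn_subRL addn1 lt_ij.
Qed.

End BraidRelations.

(** * The standard generators of the braid group, and a central power of gamma *)

Section BraidGroup.
Local Open Scope group_scope.

Variable n : nat.

Definition bsigma_nat (i : nat) : braid_group n.+2 :=
  bsigma (n := n.+2) (inord i).

Lemma bsigma_natE (i : 'I_n.+1) : bsigma_nat i = bsigma (n := n.+2) i.
Proof. by rewrite /bsigma_nat inord_val. Qed.

Lemma bsigma_nat_braid i : (i.+1 < n.+1)%N ->
  bsigma_nat i * bsigma_nat i.+1 * bsigma_nat i =
  bsigma_nat i.+1 * bsigma_nat i * bsigma_nat i.+1.
Proof.
move=> lt_in; have : (inord i.+1 : 'I_n.+1) = (inord i : 'I_n.+1).+1 :> nat.
  by rewrite !inordK ?(ltnW lt_in).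
move=> /(@braid_rel_braid n.+2 _ _)/pres_rel/pres_piP.
by rewrite !pres_piM !mulgA.
Qed.

Lemma bsigma_nat_comm i j : (i.+1 < j < n.+1)%N ->
  commute (bsigma_nat i) (bsigma_nat j).
Proof.
case/andP=> lt_ij lt_jn.
have : (((inord i : 'I_n.+1).+1 < (inord j : 'I_n.+1)) ||
        ((inord j : 'I_n.+1).+1 < (inord i : 'I_n.+1)))%N.
  by rewrite !inordK ?lt_ij // (ltn_trans (ltnW lt_ij)).
by move=> /(@braid_rel_comm n.+2 _ _)/pres_rel/pres_piP; rewrite !pres_piM.
Qed.

Lemma bgammaE : bgamma n.+2 = \prod_(0 <= i < n.+1) bsigma_nat i.
Proof. by rewrite big_mkord; apply: eq_bigr => i _; rewrite bsigma_natE. Qed.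

Lemma bgammaX_central x : commute (bgamma n.+2 ^+ n.+2) x.
Proof.
elim/presented_ind: x => [|x y|x|i]; first exact: commute1.
- exact: commuteM.
- exact: commuteV.
have := commute_coxeterX bsigma_nat_braid bsigma_nat_comm (ltn_ord i).
by rewrite -bgammaE bsigma_natE.
Qed.

End BraidGroup.

(** * Schur's lemma over an algebraically closed field *)

Section Schur.
Import GRing.Theory.

Lemma leigenvalue_exists (C : numClosedFieldType) (V : vectType C)
    (f : 'End(V)) : (fullv : {vspace V}) <> 0%VS ->
  exists a, lker (f - a *: \1%VF) != 0%VS.
Proof.
move/eqP=> V_neq0; have e_basis := vbasisP (fullv : {vspace V}).
have [a a_eigen] : exists a, eigenvalue
    (passmx.mxof (vbasis fullv) (vbasis fullv) f) a.
  by apply: eigenvalue_closed; rewrite lt0n dimv_eq0.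
exists a; rewrite -/(passmx.leigenspace f a) (passmx.leigenspaceE e_basis).
by rewrite passmx.vsof_eq0.
Qed.

(** An eigenspace of [rho x] is nonzero and, as [x] is central, invariant; irreducibility makes it
    the whole space. *)
Lemma schur (C : numClosedFieldType) (V : vectType C) (G : groupType)
    (rho : {multiplicative G -> GL V}) (x : G) :
    irreducible rho -> (forall y, commute x y) ->
  exists c, rho x = c *: \1%VF :> 'End(V).
Proof.
case=> V_neq0 irr_rho cx; have [a ker_neq0] := leigenvalue_exists (rho x) V_neq0.
set U := lker _ in ker_neq0; exists a.
have U_mem v : (v \in U) = ((rho x : 'End(V)) v == a *: v).
  by rewrite memv_ker add_lfunE opp_lfunE scale_lfunE id_lfunE subr_eq0.
case: (irr_rho U) => [y|U0|UT]; last 2 first.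
- by rewrite U0 eqxx in ker_neq0.
- apply/lfunP => v; rewrite scale_lfunE id_lfunE.
  by apply/eqP; rewrite -U_mem UT memvf.
apply/subvP => _ /memv_imgP[v vU ->].
move: vU; rewrite !U_mem -linearZ => /eqP <-.
have /(congr1 (fun f : GL V => (f : 'End(V)) v)) := gmulf_commute rho (cx y).
by rewrite /= !lfunE /= => ->.
Qed.

End Schur.

Lemma irreducible_indecomposable (F : fieldType) (V : vectType F)
    (G : groupType) (rho : {multiplicative G -> GL V}) :
  irreducible rho -> indecomposable rho.
Proof.
case=> V_neq0 irr_rho; split=> // U W invU _ _ capUW.
have [->|UT] := irr_rho U invU; first by left.
by right; rewrite -capUW UT capfv.
Qed.

(** A larger image has fewer invariant subspaces, so any splitting for [rho'] is one for [rho]. *)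
Lemma indecomposable_extend (F : fieldType) (V : vectType F)
    (G H : groupType) (rho : {multiplicative G -> GL V})
    (rho' : {multiplicative H -> GL V}) :
    (forall x, exists y, rho x = rho' y) ->
  indecomposable rho -> indecomposable rho'.
Proof.
move=> sub_rho [V_neq0 ind_rho]; split=> // U W invU invW; apply: ind_rho => x.
  by have [y ->] := sub_rho x; apply: invU.
by have [y ->] := sub_rho x; apply: invW.
Qed.

(** * Nonzero scalars as central elements of GL(V) *)

Section ScalarGL.
Import GRing.Theory.

Variables (F : fieldType) (V : vectType F) (z : F).
Hypothesis z_neq0 : z != 0.

Lemma lker0_scalar : lker (z *: \1 : 'End(V))%VF == 0%VS.
Proof. by apply/lker0P => u v; rewrite !scale_lfunE !id_lfunE; apply: scalerI. Qed.

Definition GL_scalar : GL V := MkGL lker0_scalar.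

Lemma GL_scalar_mulE (f : GL V) :
  (GL_scalar * f)%g = z *: (f : 'End(V)) :> 'End(V).
Proof. by rewrite /= -comp_lfunZl comp_lfun1l. Qed.

Lemma commute_GL_scalar (f : GL V) : commute f GL_scalar.
Proof.
by apply: val_inj; rewrite [RHS]GL_scalar_mulE /= -comp_lfunZr comp_lfun1r.
Qed.

Lemma GL_scalarX k : (GL_scalar ^+ k)%g = z ^+ k *: \1%VF :> 'End(V).
Proof.
elim: k => [|k IHk]; first by rewrite expr0 scale1r.
by rewrite expgS GL_scalar_mulE IHk scalerA -exprS.
Qed.

End ScalarGL.

(** * The necklace relations in the image of the braid group *)

Section NecklaceExtension.
Import GRing.Theory.

Variables (n : nat) (F : fieldType) (V : vectType F).
Variable rho : {multiplicative braid_group n.+2 -> GL V}.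
Variables (c z : F).
Hypothesis rho_gamma :
  rho (bgamma n.+2 ^+ (2 * n.+2))%g = c *: \1%VF :> 'End(V).
Hypothesis zV : z ^+ (2 * n.+2) = c^-1.
Hypothesis V_neq0 : (fullv : {vspace V}) <> 0%VS.

(** Otherwise an invertible operator would vanish on a nonzero space. *)
Lemma gamma_scalar_neq0 : c != 0.
Proof.
apply/eqP => c0; apply: V_neq0; apply/eqP; rewrite -subv0.
have /eqP <- := GL_ker0 (rho (bgamma n.+2 ^+ (2 * n.+2))%g).
by apply/subvP => v _; rewrite memv_ker rho_gamma c0 scale0r lfunE.
Qed.

Lemma root_neq0 : z != 0.
Proof.
apply: contraNneq gamma_scalar_neq0 => z0.
by rewrite -invr_eq0 -zV z0 expr0n.
Qed.

Local Notation g := (bgamma n.+2).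
Let t := necklace_seq n.+1 (@bsigma_nat n).
Let tau : GL V := (GL_scalar V root_neq0 * rho g)%g.

Lemma tau_conj x : (tau * rho x * tau^-1 = rho (g * x * g^-1))%g.
Proof.
rewrite !gmulfM multiplicativeV /tau invgM -!mulgA.
by rewrite -commute_GL_scalar !mulgA mulgVK.
Qed.

Lemma tauX : (tau ^+ (2 * n.+2) = 1)%g.
Proof.
rewrite expgMn; last exact/commute_sym/commute_GL_scalar.
apply: val_inj; rewrite -multiplicativeX.
transitivity ((z ^+ (2 * n.+2) *: \1) \o (c *: \1) : 'End(V))%VF.
  by rewrite -rho_gamma -(GL_scalarX V root_neq0).
rewrite zV -comp_lfunZl comp_lfun1l scalerA mulVf ?gamma_scalar_neq0 //.
exact: scale1r.
Qed.

(** Only the wrap-around at [i = n.+1] has content: there [t n.+2 = t 0] by periodicity. *)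
Lemma necklace_seq_ordS (i : 'I_n.+2) : t (ordS i) = t i.+1.
Proof.
rewrite /t /=; have [->|neq_i] := eqVneq (i : nat) n.+1.
  have bb := @bsigma_nat_braid n; have cc := @bsigma_nat_comm n.
  by rewrite modnn (necklace_seq_period bb cc) // (necklace_seq_id bb cc).
by rewrite modn_small // ltn_neqAle eqSS neq_i ltn_ord.
Qed.

Lemma necklace_extension :
  exists rho' : {multiplicative necklace_group n.+2 -> GL V},
    (forall i : 'I_n.+2, rho' (nsigma i) = rho (t i)) /\ rho' (ntau n.+2) = tau.
Proof.
have bb := @bsigma_nat_braid n; have cc := @bsigma_nat_comm n.
pose f (a : option 'I_n.+2) := if a is Some i then rho (t i) else tau.
have [|rho' rho'E] := @presented_lift _ (@necklace_rel n.+2) _ f; last first.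
  by exists rho'; split=> [i|]; exact: rho'E.
move=> u v [i s s'|i j neq_ij neq_ji s s'|i t0|].
- rewrite !word_eval_cat !word_eval_gen /f necklace_seq_ordS -!gmulfM.
  by rewrite (mulgA (t i)) (mulgA (t i.+1)) (necklace_seq_braid bb cc).
- rewrite !word_eval_cat !word_eval_gen /f; apply: gmulf_commute.
  wlog le_ij : i j neq_ij neq_ji {s s'} / (i <= j)%N.
    by move=> th; case/orP: (leq_total i j) => ?; [|apply: commute_sym]; exact: th.
  have [/val_inj->//|neq] := eqVneq (i : nat) j.
  have lt_ij : (i.+1 < j)%N.
    (* The case [j = i.+1] is excluded by [j != ordS i]. *)
    rewrite ltn_neqAle ltn_neqAle neq le_ij !andbT.
    apply: contraNneq neq_ji => eq_ij; apply/eqP/val_inj => /=.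
    by rewrite modn_small eq_ij.
  apply: necklace_seq_comm => //.
  (* Distance [n.+1] would force [j = n.+1] and [i = 0], that is [i = ordS j]. *)
  rewrite ltn_neqAle (leq_trans (leq_subr i j)) -1?ltnS // andbT.
  apply: contraNneq neq_ij => eq_ji; apply/eqP/val_inj => /=.
  have := leq_subr i j; rewrite eq_ji => le_nj.
  have jE : j = n.+1 :> nat by apply/eqP; rewrite eqn_leq le_nj -ltnS ltn_ord.
  rewrite jE modnn; apply/eqP; rewrite -leqn0 -(leq_add2l n.+1) addn0.
  by rewrite -{1}eq_ji subnK // jE.
- rewrite !word_eval_cat word_eval_genV !word_eval_gen mulgA /f tau_conj.
  by rewrite necklace_seq_ordS bgammaE /t necklace_seqS.
- rewrite [RHS]big_nil -tauX.
  elim: (2 * n.+2)%N => [|k IHk]; first exact: big_nil.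
  by rewrite expgS -IHk /= -cat1s word_eval_cat [word_eval f [:: _]]word_eval_gen.
Qed.

End NecklaceExtension.

(** * Extension to the necklace braid group, with [n.+2] strands encoding the bound *)

Theorem lemma2p1 (R : realType) (n : nat) (V : vectType R[i])
    (rho : {multiplicative braid_group n.+2 -> GL V}) :
  (irreducible rho ->
     indecomposable rho /\
     exists c : R[i], rho (bgamma n.+2 ^+ (2 * n.+2))%g = c *: \1%VF :> 'End(V))
  /\
  (indecomposable rho ->
   forall c : R[i],
     rho (bgamma n.+2 ^+ (2 * n.+2))%g = c *: \1%VF :> 'End(V) ->
   forall z : R[i], z ^+ (2 * n.+2) = c^-1 ->
   exists rho' : {multiplicative necklace_group n.+2 -> GL V},
     [/\ indecomposable rho',
         forall i : 'I_n.+1,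
           rho' (nsigma (widen_ord (leqnSn n.+1) i)) =
           rho (bsigma (n := n.+2) i),
         rho' (nsigma ord_max) =
           rho (bgamma n.+2 * bsigma (n := n.+2) ord_max
                * (bgamma n.+2)^-1)%g
       & rho' (ntau n.+2) = z *: (rho (bgamma n.+2) : 'End(V)) :> 'End(V)]).
Proof.
split=> [irr_rho|ind_rho c rho_gamma z zV].
  split; first exact: irreducible_indecomposable.
  (* The element is the square of the central [bgamma n.+2 ^+ n.+2]. *)
  apply: schur irr_rho _ => x; rewrite mulnC expgnA.
  exact/commute_sym/commuteX/commute_sym/bgammaX_central.
have bb := @bsigma_nat_braid n; have cc := @bsigma_nat_comm n.
have [rho' [rho'_sigma rho'_tau]] :=
  necklace_extension rho_gamma zV ind_rho.1.
have rho'_bsigma (i : 'I_n.+1) :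
    rho' (nsigma (widen_ord (leqnSn n.+1) i)) = rho (bsigma (n := n.+2) i).
  by rewrite rho'_sigma (necklace_seq_id bb cc) /= ?bsigma_natE.
exists rho'; split=> //; last by rewrite rho'_tau GL_scalar_mulE.
(* The image of [rho] lies in that of [rho'], as its generators do. *)
- apply: (indecomposable_extend _ ind_rho); elim/presented_ind.
  + by exists 1%g; rewrite !multiplicative1.
  + by move=> x y [x' xx'] [y' yy']; exists (x' * y')%g; rewrite !gmulfM xx' yy'.
  + by move=> x [x' xx']; exists x'^-1%g; rewrite !multiplicativeV xx'.
  + by move=> i; exists (nsigma (widen_ord (leqnSn n.+1) i)); rewrite rho'_bsigma.
(* [ord_max] has value [n.+1], so [t n.+1] is the conjugate by gamma of [t n], the last braid
   generator. *)
- rewrite rho'_sigma /= -necklace_seqS -bgammaE (necklace_seq_id bb cc) //.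
  by rewrite -bsigma_natE.
Qed.
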